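(* Let $A_i,B_i$ ($i=1,2,3,4$) be closed linear operators in a complex Hilbert space $\mathbb{H}$, $\mathcal{A}=\begin{pmatrix}A_1&A_2\\ A_3&A_4\end{pmatrix}$, $\mathcal{B}=\begin{pmatrix}B_1&B_2\\ B_3&B_4\end{pmatrix}$. For $\lambda\in\rho(A_4,B_4)$ put $S_1(\lambda)=(\lambda B_2-A_2)(\lambda B_4-A_4)^{-1}(\lambda B_3-A_3)+A_1$, $F_1(\lambda)=(\lambda B_2-A_2)(\lambda B_4-A_4)^{-1}$, $G_1(\lambda)=(\lambda B_4-A_4)^{-1}(\lambda B_3-A_3)$. Assume: (L1) the pencil $(A_4,B_4)$ is closed and densely defined, and $\rho(A_4,B_4)\neq\emptyset$; (L2) $D(A_4)\cap D(B_4)\subseteq D(A_2)\cap D(B_2)$ and $F_1(\lambda)$ is bounded for every $\lambda\in\rho(A_4,B_4)$; (L3) $G_1(\lambda)$ is bounded on $D(A_3)\cap D(B_3)$ for every $\lambda\in\rho(A_4,B_4)$; (L4) $D(A_1)\cap D(B_1)\cap D(A_3)\cap D(B_3)$ is dense and $\lambda B_1-S_1(\lambda)$ is closed for every $\lambda\in\rho(A_4,B_4)$. Let $\epsilon>0$. Then for every $\lambda\in\Lambda_\epsilon(\mathcal{A},\mathcal{B})\cap\rho(A_4,B_4)$, $$\lambda\in\Lambda_{\epsilon(1+\eta_1)(1+\eta_2)}(A_4,B_4)\cup\Lambda_{\epsilon(1+\eta_1)(1+\eta_2)}(S_1(\lambda),B_1),$$ where $\eta_1=\|(\lambda B_4-A_4)^{-1}(\lambda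 B_3-A_3)\|$ and $\eta_2=\|(\lambda B_2-A_2)(\lambda B_4-A_4)^{-1}\|$.
   Context: For operators $A,B$ in a Hilbert space and $\lambda\in\mathbb{C}$, the pencil $(A,B)$ is $\lambda\mapsto\lambda B-A$, with domain $D(A)\cap D(B)$; the pencil being closed and densely defined means that the operators $\lambda B-A$ on this domain are. $\rho(A,B)$ is the set of $\lambda\in\mathbb{C}$ for which $(\lambda B-A)^{-1}$ is a bounded everywhere-defined operator, $\sigma(A,B)=\mathbb{C}\setminus\rho(A,B)$, and for $\epsilon>0$, $\Lambda_\epsilon(A,B)=\sigma(A,B)\cup\{\lambda\in\mathbb{C}:\|(\lambda B-A)^{-1}\|\ge\epsilon^{-1}\}$. Block operators act in $\mathbb{H}\times\mathbb{H}$ (Hilbert direct sum norm) with $D(\mathcal{A})=(D(A_1)\cap D(A_3))\times(D(A_2)\cap D(A_4))$, $D(\mathcal{B})=(D(B_1)\cap D(B_3))\times(D(B_2)\cap D(B_4))$, and $\lambda\mathcal{B}-\mathcal{A}$ has entries $\lambda B_i-A_i$ and domain $D(\mathcal{A})\cap D(\mathcal{B})$. Operators built by sums and products have their natural domains, and norms are operator norms on those domains. In $\Lambda_{r}(S_1(\lambda),B_1)$ the operator $S_1(\lambda)$ is held fixed, so $\lambda\in\Lambda_{r}(S_1(\lambda),B_1)$ means that $\lambda B_1-S_1(\lambda)$ has no bounded everywhere-defined inverse or $\|(\lambda B_1-S_1(\lambda))^{-1}\|\ge r^{-1}$. *)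

(* Defs.v *)
From HB Require Import structures.
From mathcomp Require Import all_boot all_order all_algebra complex.
From mathcomp Require Import ring lra.
From mathcomp Require Import all_classical all_reals all_analysis.

Set Implicit Arguments.
Unset Strict Implicit.
Unset Printing Implicit Defensive.

Import Order.TTheory GRing.Theory Num.Theory.
Import numFieldNormedType.Exports.

Local Open Scope classical_set_scope.
Local Open Scope complex_scope.
Local Open Scope ring_scope.

HB.mixin Record isHilbert (R : realType) H & CompleteNormedModule R[i] H := {
  inner : {dot H for (@Num.conj R[i])} ;
  innerE : forall x : H, inner x x = `|x| ^+ 2
}.

#[short(type="hilbertType")]
HB.structure Definition Hilbert (R : realType) :=
  {H of CompleteNormedModule R[i] H & isHilbert R H}.

(* The library's norm on [H * K] is the maximum of the two norms; this alias
   carries the Hilbert norm instead. *)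
Definition hsum (R : realType) (H K : hilbertType R) : Type := (H * K)%type.

Section HilbertSum.
Context (R : realType) (H K : hilbertType R).
Local Notation HK := (hsum H K).

HB.instance Definition _ := GRing.Lmodule.copy HK (H * K)%type.

Definition hsum_norm (p : HK) : R[i] := sqrtC (`|p.1| ^+ 2 + `|p.2| ^+ 2).

Let hsum_sqr_ge0 (p : HK) : 0 <= `|p.1| ^+ 2 + `|p.2| ^+ 2 :> R[i].
Proof. by rewrite addr_ge0 // exprn_ge0. Qed.

Lemma hsum_norm_ge0 (p : HK) : 0 <= hsum_norm p.
Proof. by rewrite sqrtC_ge0. Qed.

Lemma hsum_norm_sqr (p : HK) : hsum_norm p ^+ 2 = `|p.1| ^+ 2 + `|p.2| ^+ 2.
Proof. by rewrite sqrtCK. Qed.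

Lemma hsum_norm_fst (p : HK) : `|p.1| <= hsum_norm p.
Proof.
rewrite -(@ler_pXn2r _ 2) ?nnegrE ?hsum_norm_ge0 // hsum_norm_sqr.
by rewrite lerDl exprn_ge0.
Qed.

Lemma hsum_norm_snd (p : HK) : `|p.2| <= hsum_norm p.
Proof.
rewrite -(@ler_pXn2r _ 2) ?nnegrE ?hsum_norm_ge0 // hsum_norm_sqr.
by rewrite lerDr exprn_ge0.
Qed.

Lemma hsum_norm_le (p : HK) : hsum_norm p <= `|p.1| + `|p.2|.
Proof.
rewrite -(@ler_pXn2r _ 2) ?nnegrE ?hsum_norm_ge0 ?addr_ge0 //.
by rewrite hsum_norm_sqr sqrrD lerD2r lerDl mulrn_wge0 // mulr_ge0.
Qed.

Lemma ler_hsum_normD (p q : HK) : hsum_norm (p + q) <= hsum_norm p + hsum_norm q.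
Proof.
have [np nq] := (hsum_norm_ge0 p, hsum_norm_ge0 q).
rewrite -(@ler_pXn2r _ 2) ?nnegrE ?hsum_norm_ge0 ?addr_ge0 //.
rewrite sqrrD !hsum_norm_sqr.
have sqD (V : hilbertType R) (x y : V) :
    `|x + y| ^+ 2 <= `|x| ^+ 2 + `|x| * `|y| *+ 2 + `|y| ^+ 2.
  by rewrite -sqrrD (@ler_pXn2r _ 2) ?nnegrE ?addr_ge0 // ler_normD.
apply: (le_trans (lerD (sqD _ p.1 q.1) (sqD _ p.2 q.2))).
have CS : `|p.1| * `|q.1| + `|p.2| * `|q.2| <= hsum_norm p * hsum_norm q.
  rewrite -(@ler_pXn2r _ 2) ?nnegrE ?addr_ge0 ?mulr_ge0 //.
  rewrite [leRHS]exprMn !hsum_norm_sqr -subr_ge0.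
  set a := `|p.1|; set b := `|p.2|; set c := `|q.1|; set d := `|q.2|.
  have -> : (a ^+ 2 + b ^+ 2) * (c ^+ 2 + d ^+ 2) - (a * c + b * d) ^+ 2
      = (a * d - b * c) ^+ 2 by rewrite !expr2; ring.
  by rewrite real_exprn_even_ge0 // rpredB // rpredM // normr_real.
rewrite -subr_ge0 in CS; rewrite -subr_ge0.
set h := hsum_norm p * hsum_norm q in CS *.
rewrite [X in 0 <= X](_ : _ =
  (h - (`|p.1| * `|q.1| + `|p.2| * `|q.2|)) *+ 2); first exact: mulrn_wge0.
by rewrite !mulr2n; ring.
Qed.

Lemma hsum_normZ (l : R[i]) (p : HK) : hsum_norm (l *: p) = `|l| * hsum_norm p.
Proof.
rewrite /hsum_norm /= !normrZ !exprMn -mulrDr sqrtCM ?nnegrE ?exprn_ge0 //.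
by rewrite sqrCK.
Qed.

Lemma hsum_norm_eq0 (p : HK) : hsum_norm p = 0 -> p = 0.
Proof.
move=> p0; have := hsum_norm_fst p; have := hsum_norm_snd p.
by rewrite p0 !normr_le0; case: p {p0} => x y /= /eqP -> /eqP ->.
Qed.

HB.instance Definition _ := @Lmodule_isNormed.Build R[i] HK
  hsum_norm ler_hsum_normD hsum_normZ hsum_norm_eq0.

Lemma hsum_normE (p : HK) : `|p| = sqrtC (`|p.1| ^+ 2 + `|p.2| ^+ 2).
Proof. by []. Qed.

Lemma hsum_complete (F : set_system HK) : ProperFilter F -> cauchy F -> cvg F.
Proof.
move=> FF /cauchyP cF.
have c1 : cvg ((fst : HK -> H) @ F).
  apply: cauchy_cvg; apply/cauchyP => e /cF[x Fx]; exists x.1.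
  apply: (@filterS _ F _ _ _ _ Fx) => y; rewrite -!ball_normE /=.
  exact/le_lt_trans/(hsum_norm_fst (x - y)).
have c2 : cvg ((snd : HK -> K) @ F).
  apply: cauchy_cvg; apply/cauchyP => e /cF[x Fx]; exists x.2.
  apply: (@filterS _ F _ _ _ _ Fx) => y; rewrite -!ball_normE /=.
  exact/le_lt_trans/(hsum_norm_snd (x - y)).
apply/cvg_ex; exists (lim ((fst : HK -> H) @ F), lim ((snd : HK -> K) @ F)).
apply/cvgrPdist_lt => e e0.
have e20 : 0 < e / 2 by rewrite divr_gt0.
have F1 := (cvgrPdist_lt _ _).1 c1 _ e20.
have F2 := (cvgrPdist_lt _ _).1 c2 _ e20.
near=> y; apply: (le_lt_trans (hsum_norm_le _)).
rewrite [e]splitr; apply: ltrD; near: y.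
  exact: F1.
exact: F2.
Unshelve. all: by end_near. Qed.

HB.instance Definition _ := @Uniform_isComplete.Build HK hsum_complete.

Definition hsum_inner (p q : HK) : R[i] := inner p.1 q.1 + inner p.2 q.2.

Lemma hsum_inner_bilinear :
  bilinear_for *%R (@Num.conj R[i] \; *%R) hsum_inner.
Proof.
split=> [q|p] a x y; rewrite /hsum_inner /=.
  by rewrite !linearPl mulrDr addrACA.
by rewrite !linearPr mulrDr addrACA.
Qed.

HB.instance Definition _ :=
  bilinear_isBilinear.Build _ _ _ _ _ _ hsum_inner hsum_inner_bilinear.

Lemma hsum_inner_hermitian (p q : HK) :
  hsum_inner p q = (-1) ^+ false * Num.conj (hsum_inner q p).
Proof.
rewrite /hsum_inner rmorphD mulrDr; congr (_ + _); exact: hermitian_subproof.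
Qed.

HB.instance Definition _ :=
  isHermitianSesquilinear.Build _ _ _ _ hsum_inner hsum_inner_hermitian.

Lemma hsum_innerE (p : HK) : hsum_inner p p = `|p| ^+ 2.
Proof. by rewrite [RHS]hsum_norm_sqr -!innerE. Qed.

Lemma hsum_inner_gt0 (p : HK) : p != 0 -> 0 < hsum_inner p p.
Proof. by move=> p0; rewrite hsum_innerE exprn_gt0 // normr_gt0. Qed.

HB.instance Definition _ :=
  isDotProduct.Build _ _ hsum_inner hsum_inner_gt0.

HB.instance Definition _ := @isHilbert.Build R HK hsum_inner hsum_innerE.

End HilbertSum.

(* Unbounded operators: only the values of [opfun] on [opdom] matter.  Linearity
   is a separate predicate because the inverse below is total on partial maps. *)
Record operator (H : Type) := Operator { opdom : set H ; opfun :> H -> H }.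

Section Operators.
Context (R : realType) (H : hilbertType R).
Implicit Types (A B S T : operator H) (lam : R[i]) (r : R).

Definition linear_operator T :=
  opdom T 0 /\
  forall (a : R[i]) x y, opdom T x -> opdom T y ->
    opdom T (a *: x + y) /\ T (a *: x + y) = a *: T x + T y.

Definition closed_operator T :=
  closed [set p : H * H | opdom T p.1 /\ p.2 = T p.1].

Definition closed_linear_operator T := linear_operator T /\ closed_operator T.

Definition densely_defined T := dense (opdom T).

Definition bounded_operator T :=
  exists M : R, forall x, opdom T x -> `|T x| <= M%:C * `|x|.

(* [`|x|] lives in [R[i]], hence the real part. *)
Definition opnorm T : \bar R :=
  ereal_sup [set (complex.Re `|T x|)%:E | x in opdom T `&` [set x | `|x| <= 1]].

Definition op_add S T : operator H :=
  Operator (opdom S `&` opdom T) (fun x => S x + T x).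

Definition op_comp S T : operator H :=
  Operator (opdom T `&` T @^-1` opdom S) (fun x => S (T x)).

(* The inverse operator when [T] is injective on its domain; otherwise it picks
   an arbitrary preimage. *)
Definition op_inv T : operator H :=
  Operator (T @` opdom T) (fun y => xget 0 (opdom T `&` T @^-1` [set y])).

Definition has_bounded_inverse T :=
  [/\ {in opdom T &, injective T}, opdom (op_inv T) = setT
    & bounded_operator (op_inv T)].

(* [pencil A B lam] is [lam B - A]. *)
Definition pencil A B lam : operator H :=
  Operator (opdom A `&` opdom B) (fun x => lam *: B x - A x).

Definition closed_pencil A B := forall lam, closed_operator (pencil A B lam).

Definition densely_defined_pencil A B :=
  forall lam, densely_defined (pencil A B lam).

Definition pencil_resolvent_set A B : set R[i] :=
  [set lam | has_bounded_inverse (pencil A B lam)].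

Definition pencil_spectrum A B : set R[i] := ~` pencil_resolvent_set A B.

Definition pencil_pseudospectrum r A B : set R[i] :=
  pencil_spectrum A B `|`
  [set lam | (r^-1%:E <= opnorm (op_inv (pencil A B lam)))%E].

Definition block_operator A1 A2 A3 A4 : operator (hsum H H) :=
  @Operator (hsum H H)
    [set p | (opdom A1 `&` opdom A3) p.1 /\ (opdom A2 `&` opdom A4) p.2]
    (fun p => (A1 p.1 + A2 p.2, A3 p.1 + A4 p.2)).

Definition F1 A2 B2 A4 B4 lam : operator H :=
  op_comp (pencil A2 B2 lam) (op_inv (pencil A4 B4 lam)).

Definition G1 A3 B3 A4 B4 lam : operator H :=
  op_comp (op_inv (pencil A4 B4 lam)) (pencil A3 B3 lam).

Definition S1 A1 A2 B2 A3 B3 A4 B4 lam : operator H :=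
  op_add (op_comp (pencil A2 B2 lam)
            (op_comp (op_inv (pencil A4 B4 lam)) (pencil A3 B3 lam))) A1.

End Operators.

(* Main.v *)
Require Import Defs.
From HB Require Import structures.
From mathcomp Require Import all_boot all_order all_algebra complex.
From mathcomp Require Import all_classical all_reals all_analysis.

Set Implicit Arguments.
Unset Strict Implicit.

Import Order.TTheory GRing.Theory Num.Theory.
Import numFieldNormedType.Exports.

Local Open Scope classical_set_scope.
Local Open Scope complex_scope.
Local Open Scope ring_scope.

(** Write [T_i = lam B_i - A_i].  Since [D(T_4)] is contained in [D(T_2)] and
    [T_4] is invertible, block elimination gives, as an equality of unbounded
    operators,
<<
      [ T_1 T_2 ]   [ 1 F ] [ S  0  ] [ 1 0 ]
      [ T_3 T_4 ] = [ 0 1 ] [ 0 T_4 ] [ G 1 ]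
>>
    with [F = T_2 T_4^-1], [G = T_4^-1 T_3] and the Schur complement
    [S = T_1 - T_2 T_4^-1 T_3], which is exactly [lam B_1 - S_1(lam)]
    ([pencil_S1]).  The outer factors are unipotent, with inverses of norm at
    most [1 + eta2] and [1 + eta1].

    The theorem is proved by contraposition.  If [lam] lies in neither
    pseudospectrum on the right, then [S] and [T_4] have bounded inverses, both
    of norm at most some [m < 1 / (eps (1 + eta1) (1 + eta2))].  The factorisation
    then inverts the block operator, and bounds the norm of its inverse by
    [(1 + eta1) m (1 + eta2) < 1 / eps] ([block_inverse]); so [lam] is outside
    the [eps]-pseudospectrum of the block pencil.  The strict inequality survives
    because the inverse of the diagonal factor has for norm the larger of only
    two norms, each of them strictly below the threshold.

    The factorisation is used in solved form: [block_operatorP] states that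
    [T (x, y) = (u, v)] amounts to the triangular system
    [S x = u - F v], [y = T_4^-1 v - G x]. *)

(** * Linear operators and their inverses *)

Section LinearOperators.
Context {R : realType} {H : hilbertType R}.
Implicit Types (A B S T : operator H).

Lemma linear_operator0 T : linear_operator T -> T 0 = 0.
Proof.
move=> [T0 Tlin]; have [_ E0] := Tlin 1 _ _ T0 T0.
by apply: (addrI (T 0)); move: E0; rewrite !scale1r !addr0.
Qed.

Lemma linear_operatorZ T (a : R[i]) x : linear_operator T -> opdom T x ->
  opdom T (a *: x) /\ T (a *: x) = a *: T x.
Proof.
move=> Tlin Tx; have [T0 TD] := Tlin.
by have := TD a _ _ Tx T0; rewrite linear_operator0 // !addr0.
Qed.

Lemma linear_operatorB T x y : linear_operator T -> opdom T x -> opdom T y ->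
  opdom T (x - y) /\ T (x - y) = T x - T y.
Proof.
move=> [_ Tlin] Tx Ty.
by have := Tlin (-1) _ _ Ty Tx; rewrite !scaleN1r ![- _ + _]addrC.
Qed.

Lemma linear_pencil A B (lam : R[i]) :
  linear_operator A -> linear_operator B -> linear_operator (pencil A B lam).
Proof.
move=> [A0 Alin] [B0 Blin]; split=> [//|a x y [Ax Bx] [Ay By]].
have [Axy EA] := Alin a _ _ Ax Ay; have [Bxy EB] := Blin a _ _ Bx By.
split=> //=; rewrite EA EB scalerBr !scalerDr opprD !scalerA mulrC.
by rewrite addrACA.
Qed.

Lemma linear_op_comp S T :
  linear_operator S -> linear_operator T -> linear_operator (op_comp S T).
Proof.
move=> Slin Tlin; have [T0 TD] := Tlin; have [S0 SD] := Slin.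
split=> [|a x y [Tx Sx] [Ty Sy]].
  by split=> //=; rewrite linear_operator0.
have [Txy ET] := TD a _ _ Tx Ty; have [Sxy ES] := SD a _ _ Sx Sy.
by split=> /=; [split=> //=|]; rewrite ET.
Qed.

Lemma op_invP T y : opdom (op_inv T) y ->
  opdom T (op_inv T y) /\ T (op_inv T y) = y.
Proof. by case=> x Tx Txy; apply: (xgetPex 0 (P := opdom T `&` T @^-1` [set y])); exists x. Qed.

Lemma op_invK T x : {in opdom T &, injective T} -> opdom T x ->
  op_inv T (T x) = x.
Proof.
move=> Tinj Tx; have [|dx ex] := @op_invP T (T x); first by exists x.
by apply: Tinj; rewrite ?inE.
Qed.

Lemma linear_op_inv T : {in opdom T &, injective T} ->
  linear_operator T -> linear_operator (op_inv T).
Proof.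
move=> Tinj Tlin; have [T0 TD] := Tlin.
split=> [|a y z dy dz].
  by exists 0; rewrite ?linear_operator0.
have [ty ey] := op_invP dy; have [tz ez] := op_invP dz.
have [tyz eyz] := TD a _ _ ty tz; rewrite ey ez in eyz.
by split; [exists (a *: op_inv T y + op_inv T z)|rewrite -eyz op_invK].
Qed.

End LinearOperators.

(** * Operator norms *)

Section OperatorBounds.
Context {R : realType} {H : hilbertType R}.
Implicit Types (T : operator H) (c : R).

(** The constant is a parameter, unlike in [bounded_operator], so that the bounds
    of the factors of a product can be tracked. *)
Definition op_bound T c := forall x, opdom T x -> `|T x| <= c%:C * `|x|.

Lemma normr_ReE (V : normedModType R[i]) (x : V) : (complex.Re `|x|)%:C = `|x|.
Proof. by rewrite RRe_real // normr_real. Qed.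

Lemma opnorm_le T c : 0 <= c -> op_bound T c -> (opnorm T <= c%:E)%E.
Proof.
move=> c0 Tc; apply: ge_ereal_sup => _ [x [Tx /= x1] <-].
rewrite lee_fin -lecR normr_ReE (le_trans (Tc _ Tx)) //.
by rewrite -[leRHS]mulr1 ler_wpM2l // ler0c.
Qed.

Lemma opnorm_ge0 T : opdom T 0 -> (0 <= opnorm T)%E.
Proof.
move=> T0; apply: (@le_trans _ _ (complex.Re `|T 0|)%:E).
  by rewrite lee_fin -lecR normr_ReE; exact: normr_ge0.
by apply: ereal_sup_ubound; exists 0 => //; split=> //=; rewrite normr0.
Qed.

Lemma opnorm_fin_num T : linear_operator T -> bounded_operator T ->
  opnorm T \is a fin_num.
Proof.
move=> [T0 _] [M TM]; rewrite ge0_fin_numE ?opnorm_ge0 //.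
apply: (@le_lt_trans _ _ `|M|%:E); last exact: ltry.
apply: opnorm_le => // x Tx; apply: (le_trans (TM _ Tx)).
by rewrite ler_wpM2r // lecR ler_norm.
Qed.

(** The supremum defining [opnorm] runs over the unit ball of the domain;
    linearity rescales a nonzero vector into it.  Without [bounded_operator],
    [fine] would turn an infinite norm into [0]. *)
Lemma op_bound_opnorm T : linear_operator T -> bounded_operator T ->
  op_bound T (fine (opnorm T)).
Proof.
move=> Tlin Tbd x Tx; have Tfin := opnorm_fin_num Tlin Tbd.
have [x0|x0] := eqVneq `|x| 0.
  by rewrite (normr0_eq0 x0) linear_operator0 // !normr0 mulr0.
have xgt0 : 0 < `|x| by rewrite lt_neqAle eq_sym x0 normr_ge0.
have [Tax eax] := linear_operatorZ `|x|^-1 Tlin Tx.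
rewrite -ler_pdivrMr // mulrC -[`|x|^-1]ger0_norm ?invr_ge0 // -normrZ -eax.
rewrite -normr_ReE lecR -lee_fin fineK //; apply: ereal_sup_ubound.
exists (`|x|^-1 *: x) => //; split=> //=.
by rewrite normrZ ger0_norm ?invr_ge0 // mulVf.
Qed.

End OperatorBounds.

(** * The norm of a Hilbert sum *)

Section HilbertSumNorm.
Context {R : realType} {H K : hilbertType R}.

(** This is why a diagonal operator has for norm the maximum of the norms of its
    entries, with no loss of a constant. *)
Lemma hsum_norm_mono (p q : hsum H K) (c : R[i]) : 0 <= c ->
  `|p.1| <= c * `|q.1| -> `|p.2| <= c * `|q.2| -> `|p| <= c * `|q|.
Proof.
move=> c0 h1 h2.
rewrite -(@ler_pXn2r _ 2) ?nnegrE ?mulr_ge0 // exprMn !hsum_norm_sqr mulrDr.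
by rewrite -!exprMn lerD // lerXn2r // nnegrE ?mulr_ge0.
Qed.

Lemma hsum_norm_inl (x : H) : `|((x, 0) : hsum H K)| = `|x|.
Proof. by rewrite hsum_normE /= normr0 expr0n addr0 sqrCK. Qed.

Lemma hsum_norm_inr (y : K) : `|((0, y) : hsum H K)| = `|y|.
Proof. by rewrite hsum_normE /= normr0 expr0n add0r sqrCK. Qed.

End HilbertSumNorm.

(** * Inverting a block operator through its Schur complement *)

Section BlockInverse.
Context {R : realType} {H : hilbertType R}.
Implicit Types (T : operator H).

(** The association of the triple product and its natural domain are those of
    [S1], so that [pencil_S1] is an equality of operators. *)
Definition schur T1 T2 T3 T4 : operator H :=
  let U := op_comp T2 (op_comp (op_inv T4) T3) in
  Operator (opdom T1 `&` opdom U) (fun x => T1 x - U x).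

Variables (T1 T2 T3 T4 : operator H).
Hypotheses (lin2 : linear_operator T2) (lin4 : linear_operator T4).
Hypotheses (dom42 : opdom T4 `<=` opdom T2) (inv4 : has_bounded_inverse T4).

Let inj4 : {in opdom T4 &, injective T4}. Proof. by case: inv4. Qed.
Let lin4V : linear_operator (op_inv T4). Proof. exact: linear_op_inv. Qed.
Let dom4V y : opdom (op_inv T4) y. Proof. by case: inv4 => _ ->. Qed.

(** The triple product imposes nothing beyond [opdom T3]: [T4] is onto, and its
    inverse takes its values in [opdom T4], hence in [opdom T2]. *)
Lemma schur_dom x : opdom (schur T1 T2 T3 T4) x <-> (opdom T1 `&` opdom T3) x.
Proof.
split=> [[d1 [[d3 _] _]]//|[d1 d3]]; split=> //.
split; first by split=> //; exact: dom4V.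
by apply: dom42; have [] := op_invP (dom4V (T3 x)).
Qed.

(** Block elimination: the second row gives [y] in terms of [x], and substituting
    it in the first row leaves an equation for the Schur complement.  The domain
    inclusion [dom42] makes both terms of [y] lie in [opdom T2] separately, so
    that [T2 y] can be expanded. *)
Lemma block_operatorP x y u v :
  (opdom (block_operator T1 T2 T3 T4) (x, y) /\
   block_operator T1 T2 T3 T4 (x, y) = (u, v)) <->
  [/\ opdom (schur T1 T2 T3 T4) x,
      schur T1 T2 T3 T4 x = u - op_comp T2 (op_inv T4) v &
      y = op_inv T4 v - op_comp (op_inv T4) T3 x].
Proof.
have key (z : H) : (opdom T2 `&` opdom T4) z <-> opdom T4 z.
  by split=> [[]//|d]; split=> //; exact: dom42.
have solve w : opdom T4 (op_inv T4 w) /\ T4 (op_inv T4 w) = w.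
  exact/op_invP/dom4V.
have invB a b : op_inv T4 (a - b) = op_inv T4 a - op_inv T4 b.
  by have [_ ->] := linear_operatorB lin4V (dom4V a) (dom4V b).
have T2B a b : T2 (op_inv T4 a - op_inv T4 b)
    = T2 (op_inv T4 a) - T2 (op_inv T4 b).
  by have [_ ->] := linear_operatorB lin2 (dom42 (solve a).1)
                                     (dom42 (solve b).1).
split=> [[[dx [/= d2 d4]] /= [e1 e2]]|[/schur_dom dx /= e1 ->]].
  have ey : y = op_inv T4 v - op_inv T4 (T3 x).
    by rewrite -invB -e2 addrAC subrr add0r op_invK.
  split=> //; first exact/schur_dom.
  by rewrite /= -e1 ey T2B addrA addrAC addrK.
have d4 : opdom T4 (op_inv T4 v - op_inv T4 (T3 x)).
  by rewrite -invB; case: (solve (v - T3 x)).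
split; first by split=> //=; exact/key.
rewrite /= T2B -invB (solve _).2 [T3 x + _]addrC subrK.
by rewrite addrA addrAC e1 subrK.
Qed.

(** The inverse is the product of the inverses of three factors, and the three
    steps of the bound follow them in order: the lower unipotent factor costs
    [1 + c1], the diagonal one [m], and the upper unipotent one [1 + c2]. *)
Lemma block_inverse :
  has_bounded_inverse (schur T1 T2 T3 T4) ->
  forall c1 c2 m : R, 0 <= c1 -> 0 <= c2 -> 0 <= m ->
  op_bound (op_comp (op_inv T4) T3) c1 ->
  op_bound (op_comp T2 (op_inv T4)) c2 ->
  op_bound (op_inv T4) m -> op_bound (op_inv (schur T1 T2 T3 T4)) m ->
  has_bounded_inverse (block_operator T1 T2 T3 T4) /\
  op_bound (op_inv (block_operator T1 T2 T3 T4)) ((1 + c1) * (m * (1 + c2))).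
Proof.
move=> [injS domSV _] c1 c2 m c10 c20 m0 bG bF bV bS.
have bT : op_bound (op_inv (block_operator T1 T2 T3 T4))
            ((1 + c1) * (m * (1 + c2))).
  move=> [u v] /op_invP; case: (op_inv _ _) => x y.
  move=> /block_operatorP[dx ex ->].
  set F := op_comp T2 _ in ex bF; set G := op_comp _ T3 in bG *.
  have dF : opdom F v.
    by split; [exact: dom4V|exact: dom42 (op_invP (dom4V v)).1].
  have dG : opdom G x by split; [case/schur_dom: dx|exact: dom4V].
  have lower_factor : `|(x, op_inv T4 v - G x) : hsum H H|
      <= (1 + c1)%:C * `|(x, op_inv T4 v) : hsum H H|.
    rewrite (_ : (x, _ - _) = (x, op_inv T4 v) - (0, G x) :> hsum H H); last first.
      by rewrite -{1}(subr0 x).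
    apply: (le_trans (ler_normB _ _)); rewrite hsum_norm_inr.
    rewrite rmorphD mulrDl mul1r lerD2l (le_trans (bG _ dG)) //.
    by rewrite ler_wpM2l ?ler0c // (hsum_norm_fst (x, op_inv T4 v)).
  have diag_factor : `|(x, op_inv T4 v) : hsum H H|
      <= m%:C * `|(u - F v, v) : hsum H H|.
    apply: hsum_norm_mono; rewrite ?ler0c //=; last exact: bV.
    have := bS (schur T1 T2 T3 T4 x).
    by rewrite op_invK // ex; apply; rewrite domSV.
  have upper_factor : `|(u - F v, v) : hsum H H|
      <= (1 + c2)%:C * `|(u, v) : hsum H H|.
    rewrite (_ : (_ - _, v) = (u, v) - (F v, 0) :> hsum H H); last first.
      by rewrite -{2}(subr0 v).
    apply: (le_trans (ler_normB _ _)); rewrite hsum_norm_inl.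
    rewrite rmorphD mulrDl mul1r lerD2l (le_trans (bF _ dF)) //.
    by rewrite ler_wpM2l ?ler0c // (hsum_norm_snd (u, v)).
  apply: (le_trans lower_factor); rewrite !rmorphM -!mulrA.
  rewrite ler_wpM2l ?ler0c ?addr_ge0 //; apply: (le_trans diag_factor).
  by rewrite ler_wpM2l ?ler0c.
split=> //; split; last by exists ((1 + c1) * (m * (1 + c2))).
  move=> [x y] [x' y'] /[!inE] d d' e.
  have [dx ex ->] := (block_operatorP _ _ _ _).1 (conj d (surjective_pairing _)).
  have [dx' ex' ->] := (block_operatorP _ _ _ _).1 (conj d' (surjective_pairing _)).
  rewrite e in ex *; rewrite (injS x x') ?inE //.
  by rewrite ex ex'.
rewrite -subTset => -[u v] _.
have : opdom (op_inv (schur T1 T2 T3 T4)) (u - op_comp T2 (op_inv T4) v).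
  by rewrite domSV.
case=> x dx ex.
have [d e] := (block_operatorP _ _ _ _).2 (And3 dx ex erefl).
by exists (x, op_inv T4 v - op_comp (op_inv T4) T3 x).
Qed.

Lemma linear_schur : linear_operator T1 -> linear_operator T3 ->
  linear_operator (schur T1 T2 T3 T4).
Proof.
move=> [T10 T1D] lin3.
have [U0 UD] := linear_op_comp lin2 (linear_op_comp lin4V lin3).
split=> [//|a x y [d1x dUx] [d1y dUy]].
have [d1 e1] := T1D a _ _ d1x d1y; have [dU eU] := UD a _ _ dUx dUy.
by split=> //; rewrite /schur /= e1 [X in _ - X]eU scalerBr opprD addrACA.
Qed.

End BlockInverse.

(** * Pencils of block operators *)

Section Pencils.
Context {R : realType} {H : hilbertType R}.

Lemma eq_operator (K : Type) (S T : operator K) :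
  (forall x, opdom S x <-> opdom T x) -> (forall x, S x = T x) -> S = T.
Proof.
case: S T => [D f] [E g] /= DE fg.
by congr Operator; [apply/seteqP; split=> x /DE|apply/funext].
Qed.

Variables (A1 A2 A3 A4 B1 B2 B3 B4 : operator H) (lam : R[i]).

Lemma pencil_block_operator :
  pencil (block_operator A1 A2 A3 A4) (block_operator B1 B2 B3 B4) lam =
  block_operator (pencil A1 B1 lam) (pencil A2 B2 lam)
                 (pencil A3 B3 lam) (pencil A4 B4 lam).
Proof.
apply: eq_operator => [[x y]|[x y]] /=; first by rewrite /setI /=; tauto.
by congr pair; rewrite /= scalerDr opprD addrACA.
Qed.

Lemma pencil_S1 :
  pencil (S1 A1 A2 B2 A3 B3 A4 B4 lam) B1 lam =
  schur (pencil A1 B1 lam) (pencil A2 B2 lam)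
        (pencil A3 B3 lam) (pencil A4 B4 lam).
Proof.
apply: eq_operator => x /=; first by rewrite /setI /=; tauto.
by rewrite opprD addrA addrAC.
Qed.

Lemma pencil_pseudospectrumPn (r : R) (A B : operator H) :
  ~ pencil_pseudospectrum r A B lam ->
  has_bounded_inverse (pencil A B lam) /\
  (opnorm (op_inv (pencil A B lam)) < r^-1%:E)%E.
Proof.
move=> /not_orP[/contrapT inv /negP]; rewrite -ltNge; by split.
Qed.

End Pencils.

Unset Implicit Arguments.

Theorem theorem3p5 (R : realType) (H : hilbertType R)
  (A1 A2 A3 A4 B1 B2 B3 B4 : operator H)
  (hA : [/\ closed_linear_operator A1, closed_linear_operator A2,
            closed_linear_operator A3 & closed_linear_operator A4])
  (hB : [/\ closed_linear_operator B1, closed_linear_operator B2,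
            closed_linear_operator B3 & closed_linear_operator B4])
  (L1 : [/\ closed_pencil A4 B4, densely_defined_pencil A4 B4
          & pencil_resolvent_set A4 B4 !=set0])
  (L2 : opdom A4 `&` opdom B4 `<=` opdom A2 `&` opdom B2 /\
        forall lam, pencil_resolvent_set A4 B4 lam ->
          bounded_operator (F1 A2 B2 A4 B4 lam))
  (L3 : forall lam, pencil_resolvent_set A4 B4 lam ->
          bounded_operator (G1 A3 B3 A4 B4 lam))
  (L4 : dense (opdom A1 `&` opdom B1 `&` opdom A3 `&` opdom B3) /\
        forall lam, pencil_resolvent_set A4 B4 lam ->
          closed_operator (pencil (S1 A1 A2 B2 A3 B3 A4 B4 lam) B1 lam))
  (eps : R) (heps : 0 < eps) (lam : R[i]) :
  (pencil_pseudospectrum eps (block_operator A1 A2 A3 A4)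
     (block_operator B1 B2 B3 B4) `&` pencil_resolvent_set A4 B4) lam ->
  let eta1 : R := fine (opnorm (G1 A3 B3 A4 B4 lam)) in
  let eta2 : R := fine (opnorm (F1 A2 B2 A4 B4 lam)) in
  let r := eps * (1 + eta1) * (1 + eta2) in
  (pencil_pseudospectrum r A4 B4 `|`
   pencil_pseudospectrum r (S1 A1 A2 B2 A3 B3 A4 B4 lam) B1) lam.
Proof.
move=> [pT inv4] eta1 eta2 r; apply: contrapT.
move=> /not_orP[/pencil_pseudospectrumPn[_ n4] /pencil_pseudospectrumPn[invS nS]].
have [[lA1 _] [lA2 _] [lA3 _] [lA4 _]] := hA.
have [[lB1 _] [lB2 _] [lB3 _] [lB4 _]] := hB.
have [dom42 /(_ _ inv4) bF] := L2; have bG := L3 _ inv4.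
have l2 := linear_pencil lam lA2 lB2; have l3 := linear_pencil lam lA3 lB3.
have l1 := linear_pencil lam lA1 lB1; have l4 := linear_pencil lam lA4 lB4.
have [inj4 _ b4] := inv4.
have l4V := linear_op_inv inj4 l4.
have lG := linear_op_comp l4V l3; have lF := linear_op_comp l2 l4V.
have [injS _ bS] := invS; rewrite pencil_S1 in injS bS invS nS.
have lS := linear_schur l2 l4 inv4 l1 l3.
have lSV := linear_op_inv injS lS.
have G0 : 0 <= eta1 by rewrite fine_ge0 ?opnorm_ge0 //; case: lG.
have F0 : 0 <= eta2 by rewrite fine_ge0 ?opnorm_ge0 //; case: lF.
have V0 := opnorm_ge0 l4V.1; have S0 := opnorm_ge0 lSV.1.
set N4 := opnorm (op_inv (pencil A4 B4 lam)) in n4 V0.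
set NS := opnorm (op_inv (schur _ _ _ _)) in nS S0.
pose m := Num.max (fine N4) (fine NS).
have m0 : 0 <= m by rewrite le_max fine_ge0.
have mr : m < r^-1.
  by rewrite gt_max -!lte_fin !fineK ?n4 ?nS ?opnorm_fin_num.
have weaken (T : operator H) c : op_bound T c -> c <= m -> op_bound T m.
  by move=> Tc cm x /Tc /le_trans; apply; rewrite ler_wpM2r ?lecR.
have [||||invT bT] := block_inverse l2 l4 dom42 inv4 invS G0 F0 m0.
- exact: op_bound_opnorm.
- exact: op_bound_opnorm.
- by apply: weaken (op_bound_opnorm l4V b4) _; rewrite le_max lexx.
- by apply: weaken (op_bound_opnorm lSV bS) _; rewrite le_max lexx orbT.
have small : (1 + eta1) * (m * (1 + eta2)) < eps^-1.
  rewrite mulrCA -ltr_pdivlMr ?mulr_gt0 ?ltr_pwDl //.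
  by rewrite -invfM mulrA.
case: pT; rewrite /pencil_spectrum /pencil_resolvent_set /=
  pencil_block_operator; first by apply.
apply/negP; rewrite -ltNge; apply: (le_lt_trans (opnorm_le _ bT)).
  by rewrite !mulr_ge0 // addr_ge0.
by rewrite lte_fin.
Qed.
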